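(* Let $\mathcal C$ be a minimal prime class of finite bichains $B$ such that the poset $o(B)$ has width at most two. Then $\mathcal C$ is the age of one of the bichains $B_1$, $B_1^t$ or $B_2$.
   Context: A bichain is $B=(V,(\le_1,\le_2))$ with $\le_1,\le_2$ linear orders on $V$; $o(B):=(V,\le_1\cap\le_2)$; the transpose is $B^t:=(V,(\le_2,\le_1))$. A module of $B$ is a set that is an interval of both $\le_1$ and $\le_2$ (equivalently, each outside element relates identically under both orders to all its elements); trivial modules are $\emptyset$, singletons and $V$; $B$ is prime if all modules are trivial. A hereditary class of finite bichains (closed under embedding as induced substructures) is minimal prime if it contains infinitely many prime members but every proper hereditary subclass contains only finitely many. The age of a structure is the class of its finite induced substructures up to isomorphism. $B_1:=(\mathbb N,(\le,\le_{\omega+\omega}))$ where $\le$ is the natural order and $\le_{\omega+\omega}$ puts the odd integers in natural order before all even integers in natural order. $B_2:=(\mathbb N,(\le,\le_\omega))$ where $i\le_\omega j$ iff $\sigma(i)\le\sigma(j)$, $\sigma$ the permutation with $\sigma(0)=1$, $\sigma(1)=3$, $\sigma(2n)=2n-2$, $\sigma(2n+1)=2n+3$ for $n\ge1$. *)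

(* Defs.v *)
From mathcomp Require Import all_boot.
From mathcomp Require Import zify.

Set Implicit Arguments.
Unset Strict Implicit.
Unset Printing Implicit Defensive.

Definition linear_order (T : Type) (r : rel T) : Prop :=
  [/\ reflexive r, antisymmetric r, transitive r & total r].

Record bichain (V : Type) := Bichain {
  le1 : rel V;
  le2 : rel V;
  le1_linear : linear_order le1;
  le2_linear : linear_order le2
}.

(* The vertex set may be empty. *)
Record fin_bichain := FinBichain {
  vertex :> finType;
  orders :> bichain vertex
}.

Definition transpose (V : Type) (B : bichain V) : bichain V :=
  Bichain (le2_linear B) (le1_linear B).

Definition o (V : Type) (B : bichain V) : rel V :=
  fun x y => le1 B x y && le2 B x y.

Definition antichain (V : finType) (r : rel V) (A : {set V}) : bool :=
  [forall x in A, forall y in A, r x y ==> (x == y)].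

Definition width (V : finType) (r : rel V) : nat :=
  \max_(A : {set V} | antichain r A) #|A|.

Definition is_interval (V : finType) (r : rel V) (M : {set V}) : Prop :=
  forall x y z : V, x \in M -> z \in M -> r x y -> r y z -> y \in M.

Definition is_module (B : fin_bichain) (M : {set B}) : Prop :=
  is_interval (le1 B) M /\ is_interval (le2 B) M.

Definition is_trivial (V : finType) (M : {set V}) : Prop :=
  [\/ M = set0, exists x : V, M = [set x] | M = [set: V]].

(* Bichains with at most two elements are prime. *)
Definition prime_bichain (B : fin_bichain) : Prop :=
  forall M : {set B}, is_module M -> is_trivial M.

Definition is_embedding (V W : Type) (A : bichain V) (B : bichain W)
    (f : V -> W) : Prop :=
  [/\ injective f,
      {mono f : x y / le1 A x y >-> le1 B x y} &
      {mono f : x y / le2 A x y >-> le2 B x y}].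

Definition embeds (V W : Type) (A : bichain V) (B : bichain W) : Prop :=
  exists f : V -> W, is_embedding A B f.

Definition isomorphic (V W : Type) (A : bichain V) (B : bichain W) : Prop :=
  exists2 f : V -> W, bijective f & is_embedding A B f.

Definition bichain_class := fin_bichain -> Prop.

Definition subclass (C D : bichain_class) : Prop := forall B, C B -> D B.

Definition same_class (C D : bichain_class) : Prop := forall B, C B <-> D B.

Definition proper_subclass (C D : bichain_class) : Prop :=
  subclass C D /\ ~ same_class C D.

(* In particular a hereditary class is closed under isomorphism. *)
Definition hereditary (C : bichain_class) : Prop :=
  forall A B : fin_bichain, embeds A B -> C B -> C A.

(* Finiteness is counted up to isomorphism. *)
Definition finitely_many_primes (C : bichain_class) : Prop :=
  exists (n : nat) (F : 'I_n -> fin_bichain),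
    forall B : fin_bichain, C B -> prime_bichain B ->
      exists i : 'I_n, isomorphic B (F i).

Definition minimal_prime (C : bichain_class) : Prop :=
  [/\ hereditary C,
      ~ finitely_many_primes C &
      forall D : bichain_class,
        hereditary D -> proper_subclass D C -> finitely_many_primes D].

Definition age (V : Type) (B : bichain V) : bichain_class :=
  fun A => embeds A B.

Lemma leq_linear : linear_order leq.
Proof. by split; [exact: leqnn|exact: anti_leq|exact: leq_trans|exact: leq_total]. Qed.

(* All odd integers, in natural order, before all even ones. *)
Definition le_omega_omega : rel nat :=
  fun i j => if odd i == odd j then i <= j else odd i.

Lemma le_omega_omega_linear : linear_order le_omega_omega.
Proof.
rewrite /le_omega_omega; split=> [i|i j|j i k|i j].
- by rewrite eqxx leqnn.
- by case: (odd i); case: (odd j) => //=; rewrite -eqn_leq => /eqP.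
- by case: (odd i); case: (odd j); case: (odd k) => //=; exact: leq_trans.
- by case: (odd i); case: (odd j) => //=; exact: leq_total.
Qed.

Definition sigma (n : nat) : nat :=
  match n with
  | 0 => 1
  | 1 => 3
  | _ => if odd n then n + 2 else n - 2
  end.

Lemma sigma_even n : 1 <= n -> sigma (2 * n) = 2 * n - 2.
Proof. by case: n => // n _; rewrite mulnS /=; case: ifP; lia. Qed.

Lemma sigma_odd n : 1 <= n -> sigma (2 * n + 1) = 2 * n + 3.
Proof. by case: n => // n _; rewrite mulnS /=; case: ifP; lia. Qed.

Lemma sigma_bij : bijective sigma.
Proof.
have sigmaE n : sigma n = if n == 0 then 1 else if odd n then n + 2 else n - 2.
  by case: n => [|[|n]].
exists (fun m => if m == 1 then 0 else if odd m then m - 2 else m + 2) => n;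
  rewrite sigmaE; repeat case: ifP; lia.
Qed.

Definition le_omega : rel nat := fun i j => sigma i <= sigma j.

Lemma le_omega_linear : linear_order le_omega.
Proof.
rewrite /le_omega; split=> [i|i j|j i k|i j].
- exact: leqnn.
- by rewrite -eqn_leq => /eqP; exact: (bij_inj sigma_bij).
- exact: leq_trans.
- exact: leq_total.
Qed.

Definition B1 : bichain nat := Bichain leq_linear le_omega_omega_linear.

Definition B2 : bichain nat := Bichain leq_linear le_omega_linear.

(* Main.v *)
Require Import Defs.
From mathcomp Require Import all_boot.
From mathcomp Require Import zify.
From Stdlib Require Import Classical ClassicalEpsilon.

Set Implicit Arguments.
Unset Strict Implicit.
Unset Printing Implicit Defensive.

(* A bichain is a permutation, and [o B] has width at most two iff it avoids 321.
   In the graph of inversions of a prime bichain, which is connected, either some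
   vertex has many neighbours or there is a long induced path.  In the first case
   the neighbours form a chain whose gaps must be separated by further points, and
   these alternate with the chain as in [B1] or its transpose; in the second case the
   path is, up to its ends, a prefix of [B2].  Hence one of the three bichains has all
   its prefixes in [C]; as its age contains infinitely many primes, minimality of [C]
   makes the inclusion of that age in [C] an equality. *)

(** * Balls and geodesics in finite graphs of bounded degree *)

Fixpoint ball (V : finType) (e : rel V) (v : V) (k : nat) : {set V} :=
  if k is k'.+1 then \bigcup_(x in ball e v k') (x |: [set y | e x y])
  else [set v].

Lemma ballS (V : finType) (e : rel V) (v x : V) (k : nat) :
  x \in ball e v k -> x \in ball e v k.+1.
Proof. by move=> xk; apply/bigcupP; exists x => //; rewrite setU11. Qed.

Lemma ball_leq (V : finType) (e : rel V) (v x : V) (i j : nat) :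
  i <= j -> x \in ball e v i -> x \in ball e v j.
Proof.
move=> /subnK <-; elim: (j - i) => // k IH /IH; rewrite addSn; exact: ballS.
Qed.

Lemma ball_edge (V : finType) (e : rel V) (v x y : V) (k : nat) :
  x \in ball e v k -> e x y -> y \in ball e v k.+1.
Proof. by move=> xk xy; apply/bigcupP; exists x => //; rewrite !inE xy orbT. Qed.

Lemma leq_card_bigcup (I V : finType) (A : {set I}) (F : I -> {set V}) (d : nat) :
  (forall i, #|F i| <= d) -> #|\bigcup_(i in A) F i| <= #|A| * d.
Proof.
move=> Fd; rewrite -sum_nat_const.
elim/big_rec2: _ => [|i m S _ IH]; first by rewrite cards0.
have := Fd i; have := (leq_card_setU (F i) S).1; lia.
Qed.

Lemma card_ball (V : finType) (e : rel V) (v : V) (d k : nat) :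
  (forall x, #|[set y | e x y]| <= d) -> #|ball e v k| <= d.+1 ^ k.
Proof.
move=> deg; elim: k => [|k IH] /=; first by rewrite cards1.
rewrite expnSr; apply: leq_trans (leq_mul IH (leqnn _)).
apply: leq_card_bigcup => x.
by apply: leq_trans (leq_card_setU _ _) _; rewrite cards1 add1n ltnS.
Qed.

(** A ball that no longer grows is closed under edges, so no walk from [v] can leave it. *)
Lemma ball_stable (V : finType) (e : rel V) (v : V) (k : nat) :
  (forall x, connect e v x) -> ball e v k.+1 \subset ball e v k ->
  ball e v k = [set: V].
Proof.
move=> conn /subsetP stab; apply/setP => x; rewrite in_setT.
have /connectP [p pth ->] := conn x.
have vk : v \in ball e v k by apply: (@ball_leq _ _ _ _ 0) => //; rewrite inE.
suff walk w : path e w p -> w \in ball e v k -> last w p \in ball e v k.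
  exact: walk.
elim: p w {pth} => [|y p IH] w //= /andP [wy pth] wk.
by apply: IH => //; apply: stab; apply: ball_edge wy.
Qed.

(** The hypotheses say that [x] is at distance exactly [k] from [v]; a neighbour of [x] in the
    previous ball is at distance exactly [k.-1], and induction applies to it. Each [p i] lies at
    distance exactly [i]. *)
Lemma geodesic_to (V : finType) (e : rel V) (v : V) (k : nat) (x : V) :
  x \in ball e v k -> (forall j, j < k -> x \notin ball e v j) ->
  exists p : nat -> V,
    [/\ p k = x, forall i, i < k -> e (p i) (p i.+1),
        forall i, i <= k -> p i \in ball e v i &
        forall i j, j < i -> i <= k -> p i \notin ball e v j].
Proof.
elim: k x => [|k IH] x xk far.
  exists (fun=> x); split=> [//|//|i|i j].
    by rewrite leqn0 => /eqP ->.
  by move=> ji; rewrite leqn0 => /eqP i0; rewrite i0 in ji.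
have /bigcupP [y yk] := xk; rewrite !inE => /orP [/eqP xy|yx].
  by have := far k (leqnn _); rewrite xy yk.
have fary j : j < k -> y \notin ball e v j.
  move=> jk; apply/negP => yj; have := far j.+1 jk.
  by rewrite (ball_edge yj yx).
have [p [pk pe pin pout]] := IH y yk fary.
exists (fun i => if i <= k then p i else x); split.
- by rewrite ltnn.
- move=> i; rewrite ltnS => ik; rewrite ik; case: (ltnP i k) => [/pe //|ki].
  have -> : i = k by lia.
  by rewrite pk.
- move=> i ik1; case: leqP => [/pin //|ki].
  have -> : i = k.+1 by lia.
  by [].
- move=> i j ji ik1; case: leqP => ik; first exact: pout.
  apply: far; lia.
Qed.

(** A ball of radius [k] is too small to exhaust the graph, so some vertex is at distance [k.+1]. A
    geodesic to it is induced, since an edge changes the distance from [v] by at most one. *)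
Lemma long_induced_path (V : finType) (e : rel V) (v : V) (d k : nat) :
  symmetric e -> irreflexive e -> (forall x, connect e v x) ->
  (forall x, #|[set y | e x y]| <= d) -> d.+1 ^ k < #|V| ->
  exists p : nat -> V,
    (forall i j, i <= k.+1 -> j <= k.+1 ->
       e (p i) (p j) = (i == j.+1) || (j == i.+1)) /\
    (forall i j, i <= k.+1 -> j <= k.+1 -> p i = p j -> i = j).
Proof.
move=> sym irr conn deg big.
have [x xS xk] : exists2 x, x \in ball e v k.+1 & x \notin ball e v k.
  apply/subsetPn; apply/negP => /(ball_stable conn) full.
  by have := card_ball v k deg; rewrite full cardsT leqNgt big.
have far j : j < k.+1 -> x \notin ball e v j.
  by rewrite ltnS => jk; apply/negP => /(ball_leq jk); apply/negP.
have [p [_ pe pin pout]] := geodesic_to xS far.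
have inj i j : i <= k.+1 -> j <= k.+1 -> p i = p j -> i = j.
  move=> ik jk pij; case: (ltngtP i j) => // ij.
    by have := pout j i ij jk; rewrite -pij pin.
  by have := pout i j ij ik; rewrite pij pin.
exists p; split=> //.
have lt i j : i <= k.+1 -> j <= k.+1 -> i < j -> e (p i) (p j) = (j == i.+1).
  move=> ik jk ij; case: eqP => [->|ne]; first by apply: pe; lia.
  apply/negP => /(ball_edge (pin i ik)); apply/negP; apply: pout; lia.
move=> i j ik jk; case: (ltngtP i j) => ij.
- rewrite lt //; lia.
- rewrite sym lt //; lia.
- rewrite ij irr; lia.
Qed.

(** * Many inversions at one point: separators and prefixes of [B1] *)

(** Pigeonhole: among at least [2n - 1] indices coloured by [c], one colour occurs [n] times, and
    [g] lists its occurrences in order. *)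
Lemma split_increasing (c : pred nat) (m n : nat) : n.*2 <= m.+1 ->
  exists (b : bool) (g : nat -> nat),
    (forall k, k < n -> g k < m /\ c (g k) = b) /\
    (forall k l, k < l -> l < n -> g k < g l).
Proof.
move=> nm.
suff sel (d : pred nat) : n <= count d (iota 0 m) ->
  exists g : nat -> nat, (forall k, k < n -> g k < m /\ d (g k)) /\
    (forall k l, k < l -> l < n -> g k < g l).
  have := count_predC c (iota 0 m); rewrite size_iota => tot.
  have [/sel|/sel] : n <= count c (iota 0 m) \/ n <= count (predC c) (iota 0 m).
  - by lia.
  - case=> g [gc gi]; exists true, g; split=> // k /gc [? ->] //.
  - case=> g [gc gi]; exists false, g; split=> // k /gc [? /negbTE ->] //.
rewrite -size_filter => big; exists (nth 0 [seq i <- iota 0 m | d i]).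
split=> [k kn|k l kl ln].
  have := mem_nth 0 (leq_trans kn big).
  by rewrite mem_filter mem_iota => /andP [-> /=]; rewrite add0n.
apply: (sorted_ltn_nth ltn_trans) => //; last 2 first.
- exact: leq_trans (ltn_trans kl ln) big.
- exact: leq_trans ln big.
by apply: sorted_filter => //; [exact: ltn_trans|exact: iota_ltn_sorted].
Qed.

(** Points of [V] carry positions [a] and [b] in the two orders, so that order arguments become
    arithmetic. The negation [~~ le1 X j i] expresses that [i] strictly precedes [j]; preserving
    strict order is enough because the orders are linear. *)
Definition contains_prefix (X : bichain nat) (n : nat) (V : Type)
    (a b : V -> nat) : Prop :=
  exists f : nat -> V, forall i j, i < n -> j < n ->
    (~~ le1 X j i -> a (f i) < a (f j)) /\
    (~~ le2 X j i -> b (f i) < b (f j)).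

Definition coordinate_prime (V : finType) (a b : V -> nat) : Prop :=
  forall M : {set V}, is_interval (fun x y => a x <= a y) M ->
    is_interval (fun x y => b x <= b y) M -> is_trivial M.

Definition avoids321 (V : Type) (a b : V -> nat) : Prop :=
  forall x y z, a x < a y -> a y < a z -> b z < b y -> b y < b x -> False.

(** The inversion graph of the permutation: for injective coordinates, its edges are the
    incomparable pairs of the intersection order. *)
Definition inverted (V : Type) (a b : V -> nat) : rel V :=
  fun x y => (a x < a y) && (b y < b x) || (a y < a x) && (b x < b y).

Lemma trivial_pair (V : finType) (M : {set V}) (x y z : V) :
  is_trivial M -> x \in M -> y \in M -> x <> y -> z \in M.
Proof.
case=> [->|[w ->]|->]; rewrite ?inE // => /eqP -> /eqP -> //.
Qed.

(* Two points below and to the right of [v] cannot be told apart from the inside: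
   the separating point lies between them in one order and beyond [v] in the other. *)
Lemma separator (V : finType) (a b : V -> nat) (v x x' : V) :
  injective a -> injective b -> avoids321 a b -> coordinate_prime a b ->
  a v < a x -> b x' < b v -> a x < a x' -> b x < b x' ->
  (exists y, [&& a x < a y, a y < a x' & b v < b y]) \/
  (exists y, [&& b x < b y, b y < b x' & a y < a v]).
Proof.
move=> ainj binj av pr vx x'v xx' bxx'.
(* The rectangle spanned by [x] and [x']. Without a separator it is a module, hence everything,
   although [v] lies outside it. *)
pose M := [set z | [&& a x <= a z, a z <= a x', b x <= b z & b z <= b x']].
have xM : x \in M by rewrite inE; lia.
have x'M : x' \in M by rewrite inE; lia.
have neq : x <> x' by move=> E; rewrite E ltnn in xx'.
apply: NNPP => no; have vM : v \in M.
  suff triv : is_trivial M by exact: (trivial_pair v triv xM x'M neq).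
  apply: pr.
  (* A point violating the interval condition that is not a separator would form a 321 pattern with
     [v] and one of [x], [x']. *)
  - move=> s y t; rewrite !inE => sM tM sy yt.
    apply: NNPP => /negP yM; apply: no; left; exists y.
    have : b y <> b v by move/binj => E; rewrite E in sy; lia.
    have : a y <> a x by move/ainj => E; rewrite E in yM; lia.
    have : a y <> a x' by move/ainj => E; rewrite E in yM; lia.
    have := av v x y; have := av v y x'; lia.
  - move=> s y t; rewrite !inE => sM tM sy yt.
    apply: NNPP => /negP yM; apply: no; right; exists y.
    have : a y <> a v by move/ainj => E; rewrite E in yt; lia.
    have : b y <> b x by move/binj => E; rewrite E in yM; lia.
    have : b y <> b x' by move/binj => E; rewrite E in yM; lia.
    have := av v x' y; have := av v y x; lia.
by move: vM; rewrite inE; lia.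
Qed.

(** Index [2k] goes to [y k] and [2k+1] to [x k]. The first coordinate runs through
    [y 0, x 0, y 1, x 1, ...]; the level [c] puts all [x k], the odd indices, before all [y k] in
    the second. *)
Lemma alternation_contains_B1 (V : Type) (a b : V -> nat) (c n : nat) (x y : nat -> V) :
  (forall k, k < n -> [/\ a (y k) < a (x k), b (x k) < c & c < b (y k)]) ->
  (forall k l, k < l -> l < n ->
     [/\ a (x k) < a (y l), b (x k) < b (x l) & b (y k) < b (y l)]) ->
  contains_prefix B1 n a b.
Proof.
move=> loc mono; exists (fun i => if odd i then x i./2 else y i./2) => i j ilt jlt.
have ni : i./2 < n by lia.
have nj : j./2 < n by lia.
have [ai bi ci] := loc _ ni; have [aj bj cj] := loc _ nj.
rewrite /= /le_omega_omega -ltnNge.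
case: (ltngtP i./2 j./2) => ij.
- have [? ? ?] := mono _ _ ij nj.
  by case oi: (odd i); case oj: (odd j) => /=; split; lia.
- have [? ? ?] := mono _ _ ij ni.
  by case oi: (odd i); case oj: (odd j) => /=; split; lia.
- rewrite ij in ai bi ci *.
  by case oi: (odd i); case oj: (odd j) => /=; split; lia.
Qed.

(* A chain of [m.+1] points below and to the right of [v] has [m] gaps, each with a
   separator; the separators of one kind alternate with points of the chain. *)
Lemma many_inversions_alternation (V : finType) (a b : V -> nat) (v : V) (n : nat) :
  injective a -> injective b -> avoids321 a b -> coordinate_prime a b ->
  n.*2 <= #|[set x | (a v < a x) && (b x < b v)]| ->
  contains_prefix B1 n a b \/ contains_prefix B1 n b a.
Proof.
move=> ainj binj av pr big; set S := [set x | _] in big.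
pose leqa : rel V := fun x y => a x <= a y.
pose lta : rel V := fun x y => a x < a y.
have lta_tr : transitive lta by move=> y x z; rewrite /lta; exact: ltn_trans.
pose s := sort leqa (enum S).
have sS i : i < size s -> nth v s i \in S.
  by move/(mem_nth v); rewrite mem_sort mem_enum.
have size_s : size s = #|S| by rewrite size_sort cardE.
have lta_s : sorted lta s.
  have tot : total leqa by move=> x y; exact: leq_total.
  have : sorted leqa s by apply: sort_sorted.
  have : uniq s by rewrite sort_uniq enum_uniq.
  elim: (s) => [|x [|y t] IH] //= /andP [xn un] /andP [xy st].
  apply/andP; split; last exact: IH.
  rewrite /lta ltn_neqAle; apply/andP; split=> //; apply/eqP => /ainj E.
  by move: xn; rewrite E inE eqxx.
pose x i := nth v s i; pose m := (size s).-1.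
have xS i : i <= m -> 0 < n -> a v < a (x i) /\ b (x i) < b v.
  by move=> im n0; have := sS i; rewrite inE => xi; apply/andP/xi; lia.
have xa i j : i < j -> j <= m -> 0 < n -> a (x i) < a (x j).
  move=> ij jm n0; apply: (sorted_ltn_nth lta_tr v lta_s) => //;
    rewrite inE; lia.
(* The chain also increases in [b]: otherwise [v], [x i], [x j] would be a 321 pattern. *)
have xb i j : i < j -> j <= m -> 0 < n -> b (x i) < b (x j).
  move=> ij jm n0; have aij := xa i j ij jm n0.
  have [vi iv] := xS i (leq_trans (ltnW ij) jm) n0; have [vj jv] := xS j jm n0.
  have : b (x i) <> b (x j) by move/binj => E; rewrite E ltnn in aij.
  have := av v (x i) (x j); lia.
pose above i y := [&& a (x i) < a y, a y < a (x i.+1) & b v < b y].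
pose left i y := [&& b (x i) < b y, b y < b (x i.+1) & a y < a v].
have nm : n.*2 <= m.+1 by lia.
(* A gap is coloured by whether it has a separator of the kind [above]; a gap without one has a
   separator of the kind [left]. *)
have [[] [g [gc gi]]] := split_increasing (fun i => [exists y, above i y]) nm.
(* The default [v] is never taken at the selected gaps, by [yP]. Each separator is paired with the
   right end of its gap, which keeps it before its partner in [a]. *)
- pose y i := odflt v [pick y | above i y].
  have yP k : k < n -> above (g k) (y (g k)).
    move=> kn; have [_ /existsP [z zP]] := gc k kn.
    by rewrite /y; case: pickP => [//|/(_ z)]; rewrite zP.
  left; apply: (@alternation_contains_B1 _ _ _ (b v) n
    (fun k => x (g k).+1) (fun k => y (g k))) => [k kn|k l kl ln].
    have /and3P [? ? ?] := yP k kn; have [gk _] := gc k kn.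
    have [//|_ ?] := xS (g k).+1 gk _; first lia.
    by split.
  have n0 : 0 < n by lia.
  have kn := ltn_trans kl ln; have gkl := gi k l kl ln.
  have /and3P [? ? ?] := yP k kn; have /and3P [? ? ?] := yP l ln.
  have [gl _] := gc l ln.
  have [_ ?] := xS (g l).+1 gl n0.
  have ? : b (x (g k).+1) < b (x (g l).+1) by apply: xb.
  have ? : a (x (g k).+1) <= a (x (g l)).
    by case: (ltngtP (g k).+1 (g l)) => [?|?|->//]; [apply/ltnW/xa|]; lia.
  (* If the separators decreased in [b], two of them and the later chain point below [v] would be a
     321 pattern. *)
  have : b (y (g k)) <> b (y (g l)).
    by move/binj => E; move: (yP k kn) (yP l ln); rewrite /above E; lia.
  have := av (y (g k)) (y (g l)) (x (g l).+1); split; lia.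
- pose y i := odflt v [pick y | left i y].
  have yP k : k < n -> left (g k) (y (g k)).
    move=> kn; have [gk /negbT] := gc k kn.
    rewrite negb_exists => /forallP no.
    have n0 : 0 < n by lia.
    have [vx _] := xS (g k) (ltnW gk) n0; have [_ xv] := xS (g k).+1 gk n0.
    have ax := xa _ _ (ltnSn (g k)) gk n0; have bx := xb _ _ (ltnSn (g k)) gk n0.
    have [[z zP]|[z zP]] := separator ainj binj av pr vx xv ax bx.
      by have := no z; rewrite /above zP.
    by rewrite /y; case: pickP => [//|/(_ z)]; rewrite /left zP.
  (* The coordinates exchange roles: the level is now [a v], the separators take the odd places, and
     each is paired with the left end of its gap. *)
  right; apply: (@alternation_contains_B1 _ _ _ (a v) n
    (fun k => y (g k)) (fun k => x (g k))) => [k kn|k l kl ln].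
    have /and3P [? ? ?] := yP k kn; have [gk _] := gc k kn.
    have [|//|? _] := xS (g k) _ _; [lia|lia|].
    by split.
  have n0 : 0 < n by lia.
  have kn := ltn_trans kl ln; have gkl := gi k l kl ln.
  have /and3P [? ? ?] := yP k kn; have /and3P [? ? ?] := yP l ln.
  have [gl _] := gc l ln.
  have [? _] := xS (g k) (ltnW (ltn_trans gkl gl)) n0.
  have ? : a (x (g k)) < a (x (g l)) by apply: xa => //; lia.
  have ? : b (x (g k).+1) <= b (x (g l)).
    by case: (ltngtP (g k).+1 (g l)) => [?|?|->//]; [apply/ltnW/xb|]; lia.
  have : a (y (g k)) <> a (y (g l)).
    by move/ainj => E; move: (yP k kn) (yP l ln); rewrite /left E; lia.
  have := av (y (g l)) (y (g k)) (x (g k)); split; lia.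
Qed.

(** * Connectedness of the inversion graph of a prime bichain *)

Lemma inverted_sym (V : Type) (a b : V -> nat) : symmetric (inverted a b).
Proof. move=> x y; rewrite /inverted; lia. Qed.

Lemma inverted_irr (V : Type) (a b : V -> nat) : irreflexive (inverted a b).
Proof. move=> x; rewrite /inverted; lia. Qed.

Lemma inverted_swap (V : Type) (a b : V -> nat) : inverted a b =2 inverted b a.
Proof. move=> x y; rewrite /inverted; lia. Qed.

(** A point [y] inverted with neither end of an edge cannot lie between them in [a]: it would then
    lie between them in the same direction in [b], and the ends would not be inverted. So its side
    is constant along a path. *)
Lemma component_same_side (V : finType) (a b : V -> nat) (v x y : V) :
  injective a -> injective b ->
  connect (inverted a b) v x -> ~~ connect (inverted a b) v y ->
  (a x < a y) = (a v < a y).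
Proof.
move=> ainj binj /connectP [p pth ->]; elim: p v pth => [//|w p IH] v /= /andP [vw pth] vy.
have wy : ~~ connect (inverted a b) w y.
  by apply: contra vy; apply: connect_trans; exact: connect1.
rewrite (IH w pth wy); have neq u : ~~ connect (inverted a b) u y -> a u <> a y /\ b u <> b y.
  by move=> uy; split=> [/ainj|/binj] E; move: uy; rewrite E connect0.
have [? ?] := neq v vy; have [? ?] := neq w wy.
have : ~~ inverted a b v y by apply: contra vy; exact: connect1.
have : ~~ inverted a b w y by apply: contra wy; exact: connect1.
by move: vw; rewrite /inverted; lia.
Qed.

Lemma component_interval (V : finType) (a b : V -> nat) (v : V) :
  injective a -> injective b ->
  is_interval (fun x y => a x <= a y) [set x | connect (inverted a b) v x].
Proof.
move=> ainj binj x y z; rewrite !inE => vx vz xy yz.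
apply: contraT => vy; have neq u : connect (inverted a b) v u -> a u <> a y.
  by move=> vu /ainj E; move: vy; rewrite -E vu.
have := component_same_side ainj binj vx vy; have := component_same_side ainj binj vz vy.
have := neq x vx; have := neq z vz; lia.
Qed.

(** A connected component is an interval of both orders, thus a module; the edge [v w] gives it two
    points, so primality makes it everything. *)
Lemma prime_connected (V : finType) (a b : V -> nat) (v w : V) :
  injective a -> injective b -> coordinate_prime a b -> inverted a b v w ->
  forall x, connect (inverted a b) v x.
Proof.
move=> ainj binj pr vw x; pose K := [set x | connect (inverted a b) v x].
have triv : is_trivial K.
  apply: pr; first exact: component_interval.
  have -> : K = [set x | connect (inverted b a) v x].
    by apply/setP => y; rewrite !inE; apply: eq_connect; exact: inverted_swap.
  exact: component_interval.
have : x \in K.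
  apply: (trivial_pair x triv (x := v) (y := w)); rewrite ?inE ?connect0 ?connect1 //.
  by move=> E; rewrite E inverted_irr in vw.
by rewrite inE.
Qed.

(** Without inversions the two orders coincide, and removing their common maximum leaves a
    nontrivial module. *)
Lemma prime_inversion (V : finType) (a b : V -> nat) :
  injective a -> injective b -> coordinate_prime a b -> 2 < #|V| ->
  exists v w, inverted a b v w.
Proof.
move=> ainj binj pr big; apply: NNPP => no.
have same x y : (a x < a y) = (b x < b y).
  have : ~~ inverted a b x y by apply/negP => xy; apply: no; exists x, y.
  rewrite /inverted; case: (eqVneq x y) => [->|xy]; first by rewrite !ltnn.
  have : a x <> a y by move/ainj/eqP; apply/negP.
  have : b x <> b y by move/binj/eqP; apply/negP.
  lia.
have /card_gt0P [t0 _] : 0 < #|V| by lia.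
case: (@arg_maxnP V t0 predT a isT) => t _ tmax.
have maxb x : b x <= b t by rewrite leqNgt -same -leqNgt; exact: tmax.
have triv : is_trivial (~: [set t]).
  apply: pr => x y z; rewrite !inE => xt zt xy yz; apply: contra zt => /eqP E; subst y.
    by apply/eqP/ainj; have := tmax z isT; lia.
  by apply/eqP/binj; have := maxb z; lia.
have C := cardsC1 t; case: triv => [E|[x E]|E].
- by move: C; rewrite E cards0; lia.
- by move: C; rewrite E cards1; lia.
- by have : t \in [set: V] by []; rewrite -E !inE eqxx.
Qed.

(** * Long induced paths and prefixes of [B2] *)

Definition below (V : Type) (a b : V -> nat) : rel V :=
  fun x y => (a x < a y) && (b x < b y).

Definition induced_path (V : Type) (e : rel V) (K : nat) (p : nat -> V) : Prop :=
  forall i j, i <= K -> j <= K -> e (p i) (p j) = (i == j.+1) || (j == i.+1).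

(** Nonadjacent vertices of the path are comparable. Moving one end along an edge cannot reverse the
    comparison, since transitivity would make the ends of that edge comparable. So every such pair
    is directed like [p 0], [p 2]. *)
Lemma path_direction (V : Type) (a b : V -> nat) (K : nat) (p : nat -> V) :
  injective a -> injective b -> induced_path (inverted a b) K p ->
  (forall i j, i <= K -> j <= K -> p i = p j -> i = j) ->
  (forall i j, i.+1 < j -> j <= K -> below a b (p i) (p j)) \/
  (forall i j, i.+1 < j -> j <= K -> below a b (p j) (p i)).
Proof.
move=> ainj binj path inj.
have adj i : i < K -> inverted a b (p i) (p i.+1).
  by move=> iK; rewrite path ?eqxx ?orbT //; lia.
have far i j : i.+1 < j -> j <= K -> below a b (p i) (p j) = ~~ below a b (p j) (p i).
  move=> ij jK; have : ~~ inverted a b (p i) (p j) by rewrite path; lia.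
  have neq : p i <> p j by move/inj; lia.
  have : a (p i) <> a (p j) by move/ainj.
  have : b (p i) <> b (p j) by move/binj.
  rewrite /inverted /below; lia.
have stepr i j : i.+1 < j -> j < K -> below a b (p i) (p j.+1) = below a b (p i) (p j).
  move=> ij jK; have := adj j jK; have := far i j ij (ltnW jK).
  have := far i j.+1 (leqW ij) jK; rewrite /inverted /below; lia.
have stepl i j : i.+2 < j -> j <= K -> below a b (p i.+1) (p j) = below a b (p i) (p j).
  move=> ij jK; have iK : i < K by lia.
  have := adj i iK; have := far i j (ltnW ij) jK.
  have := far i.+1 j ij jK; rewrite /inverted /below; lia.
have row i d : i.+2 + d <= K -> below a b (p i) (p (i.+2 + d)) = below a b (p i) (p i.+2).
  elim: d => [|d IH] iK; first by rewrite addn0.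
  by rewrite addnS stepr ?IH; lia.
have col i : i.+2 <= K -> below a b (p i) (p i.+2) = below a b (p 0) (p 2).
  elim: i => // i IH iK; rewrite stepl; [|lia|lia].
  by rewrite stepr; [apply: IH; lia|lia|lia].
have all i j : i.+1 < j -> j <= K -> below a b (p i) (p j) = below a b (p 0) (p 2).
  move=> ij jK; have -> : j = i.+2 + (j - i.+2) by lia.
  rewrite row ?col //; lia.
case up : (below a b (p 0) (p 2)).
  by left=> i j ij jK; rewrite all.
by right=> i j ij jK; have := far i j ij jK; rewrite all // up; case: below.
Qed.

(* The vertices 0, 2, 1, 4, 3, 6, 5, ... form, in this order, the inversion path of
   [B2]; [B2_path_index] is the inverse enumeration. *)
Definition B2_path_index (m : nat) : nat :=
  if m == 0 then 0 else if odd m then m.+1 else m.-1.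

Lemma increasing_path_contains_B2 (V : Type) (a b : V -> nat) (n : nat) (p : nat -> V) :
  induced_path (inverted a b) n p ->
  (forall i j, i.+1 < j -> j <= n -> below a b (p i) (p j)) ->
  a (p 0) < a (p 1) -> contains_prefix B2 n a b.
Proof.
move=> path up start.
(* Two consecutive steps in the same [a]-direction would invert [p i] and [p i.+2], so the
   directions alternate. *)
have alt i : i < n -> (a (p i) < a (p i.+1)) = ~~ odd i /\ inverted a b (p i) (p i.+1).
  move=> iK; have adj j : j < n -> inverted a b (p j) (p j.+1).
    by move=> jK; rewrite path ?eqxx ?orbT //; lia.
  split; last exact: adj.
  elim: i iK => [|i IH] iK; first by rewrite start.
  have := IH (ltnW iK); have := adj i (ltnW iK); have := adj i.+1 iK.
  have := up i i.+2 (ltnSn _) iK; rewrite /= /inverted /below; lia.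
have sigmaE m : sigma m = if m == 0 then 1 else if odd m then m + 2 else m - 2.
  by case: m => [|[|m]].
exists (fun m => p (B2_path_index m)) => x y xn yn.
have xK : B2_path_index x <= n by rewrite /B2_path_index; repeat case: ifP; lia.
have yK : B2_path_index y <= n by rewrite /B2_path_index; repeat case: ifP; lia.
(* Both orders are read off path positions: nonadjacent vertices follow the path, and adjacent ones
   are ordered by the parity of the earlier position, with opposite rules for the natural order and
   for [sigma]. *)
rewrite /= /le_omega -!ltnNge.
have conv : (x < y) = [|| (B2_path_index x).+1 < B2_path_index y,
    (B2_path_index y == (B2_path_index x).+1) && ~~ odd (B2_path_index x) |
    (B2_path_index x == (B2_path_index y).+1) && odd (B2_path_index y)].
  by rewrite /B2_path_index; repeat case: ifP; lia.
have convb : (sigma x < sigma y) = [|| (B2_path_index x).+1 < B2_path_index y,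
    (B2_path_index y == (B2_path_index x).+1) && odd (B2_path_index x) |
    (B2_path_index x == (B2_path_index y).+1) && ~~ odd (B2_path_index y)].
  have sigma_index m : sigma m =
      if odd (B2_path_index m) then (B2_path_index m).-1 else (B2_path_index m).+1.
    rewrite sigmaE /B2_path_index; case: (posnP m) => [//|m0].
    by case om: (odd m); case: ifP; lia.
  have neq : B2_path_index x = B2_path_index y -> x = y.
    by rewrite /B2_path_index; repeat case: ifP; lia.
  have [->|xy] := eqVneq x y; first by rewrite !ltnn; lia.
  rewrite !sigma_index; case: ifP; case: ifP; lia.
rewrite conv convb; move: (B2_path_index x) (B2_path_index y) xK yK {conv convb} => i j iK jK.
split=> /or3P [ij|/andP [/eqP ij par]|/andP [/eqP ij par]].
- by have /andP [] := up i j ij jK.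
- by subst j; have [-> _] := alt i jK.
- by subst i; have [] := alt j iK; rewrite /inverted par; lia.
- by have /andP [] := up i j ij jK.
- by subst j; have [] := alt i jK; rewrite /inverted par; lia.
- by subst i; have [] := alt j iK; rewrite /inverted par; lia.
Qed.

Lemma induced_path_contains_B2 (V : Type) (a b : V -> nat) (n : nat) (p : nat -> V) :
  injective a -> injective b -> induced_path (inverted a b) n.+2 p ->
  (forall i j, i <= n.+2 -> j <= n.+2 -> p i = p j -> i = j) ->
  contains_prefix B2 n a b.
Proof.
move=> ainj binj path inj.
(* A decreasing path is reversed. *)
wlog up : p path inj / forall i j, i.+1 < j -> j <= n.+2 -> below a b (p i) (p j).
  move=> wl; have [up|down] := path_direction ainj binj path inj; first exact: (wl p).
  apply: (wl (fun i => p (n.+2 - i))).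
  - move=> i j iK jK; rewrite path; lia.
  - move=> i j iK jK /inj E; lia.
  - move=> i j ij jK; apply: down; lia.
have [start|start] := ltnP (a (p 0)) (a (p 1)).
  apply: (@increasing_path_contains_B2 _ _ _ _ p) => //.
  - move=> i j iK jK; apply: path; lia.
  - move=> i j ij jK; apply: up; lia.
(* If the first step goes down in [a], the second goes up, so the first vertex is dropped. *)
apply: (@increasing_path_contains_B2 _ _ _ _ (fun i => p i.+1)).
- move=> i j iK jK; rewrite path; lia.
- move=> i j ij jK; apply: up; lia.
- have : inverted a b (p 0) (p 1) by rewrite path.
  have : inverted a b (p 1) (p 2) by rewrite path.
  have := up 0 2 isT isT; rewrite /inverted /below; lia.
Qed.

(** * The dichotomy between large degree and long paths *)

Lemma large_prime_contains_prefix (V : finType) (a b : V -> nat) (n : nat) :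
  injective a -> injective b -> avoids321 a b -> coordinate_prime a b ->
  (4 * n).+1 ^ n.+1 + 2 < #|V| ->
  [\/ contains_prefix B1 n a b, contains_prefix B1 n b a | contains_prefix B2 n a b].
Proof.
move=> ainj binj av pr big.
have av' : avoids321 b a by move=> x y z xy yz zy yx; apply: (av z y x).
have pr' : coordinate_prime b a by move=> M Ma Mb; apply: pr.
have [v [w vw]] : exists v w, inverted a b v w by apply: prime_inversion => //; lia.
(* More than [4n] neighbours leave at least [2n] on one side of [x]. The side with smaller [a] is
   treated by exchanging coordinates, which swaps the first two alternatives. *)
have [[x dx]|small] := classic (exists x, 4 * n < #|[set y | inverted a b x y]|).
  have sub : [set y | inverted a b x y] \subset
      [set y | (a x < a y) && (b y < b x)] :|: [set y | (b x < b y) && (a y < a x)].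
    by apply/subsetP => y; rewrite !inE /inverted; lia.
  have := subset_leq_card sub; have := (leq_card_setU
      [set y | (a x < a y) && (b y < b x)] [set y | (b x < b y) && (a y < a x)]).1.
  case: (leqP n.*2 #|[set y | (a x < a y) && (b y < b x)]|) => [many _ _|few c1 c2].
    by have [] := many_inversions_alternation ainj binj av pr many; [constructor 1|constructor 2].
  have many : n.*2 <= #|[set y | (b x < b y) && (a y < a x)]| by lia.
  by have [] := many_inversions_alternation binj ainj av' pr' many; [constructor 2|constructor 1].
have deg x : #|[set y | inverted a b x y]| <= 4 * n.
  by rewrite leqNgt; apply/negP => dx; apply: small; exists x.
have [p [path inj]] := long_induced_path (k := n.+1) (inverted_sym a b) (inverted_irr a b)
  (prime_connected ainj binj pr vw) deg (leq_ltn_trans (leq_addr 2 _) big).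
by constructor 3; apply: (@induced_path_contains_B2 _ _ _ _ p).
Qed.

(** * From linear orders to integer coordinates *)

Definition rank (V : finType) (r : rel V) (x : V) : nat := #|[set z | r z x]|.

Lemma leq_rank (V : finType) (r : rel V) (x y : V) :
  linear_order r -> (rank r x <= rank r y) = r x y.
Proof.
move=> [rr ra rt rtot]; apply/idP/idP => [|xy]; last first.
  by apply/subset_leq_card/subsetP => z; rewrite !inE => zx; apply: rt xy.
apply: contraTT => xy; rewrite -ltnNge; apply/proper_card/properP.
have yx : r y x by have := rtot x y; rewrite (negbTE xy).
split; first by apply/subsetP => z; rewrite !inE => zy; apply: rt yx.
by exists x; rewrite !inE ?rr.
Qed.

Lemma rank_inj (V : finType) (r : rel V) : linear_order r -> injective (rank r).
Proof.
move=> rl x y xy; have [_ ra _ _] := rl.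
by apply: ra; rewrite -!(leq_rank _ _ rl) xy leqnn.
Qed.

(** The three points of a 321 pattern are pairwise incomparable in [o B]. *)
Lemma width2_avoids321 (B : fin_bichain) :
  width (o B) <= 2 -> avoids321 (rank (le1 B)) (rank (le2 B)).
Proof.
move=> w x y z axy ayz bzy byx.
have anti : antichain (o B) [set x; y; z].
  apply/forallP => s; apply/implyP => sA; apply/forallP => t; apply/implyP => tA.
  apply/implyP; rewrite /o -(leq_rank _ _ (le1_linear B)) -(leq_rank _ _ (le2_linear B)).
  move: sA tA; rewrite !inE -!orbA.
  by case/or3P => /eqP -> /or3P [] /eqP -> //; lia.
have card3 : #|[set x; y; z]| = 3.
  rewrite setUC cardsU1 cards2 !inE.
  have [zx zy xy] : [/\ z <> x, z <> y & x <> y] by split=> E; subst; lia.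
  by move/eqP/negbTE: zx ->; move/eqP/negbTE: zy ->; move/eqP: xy ->.
by have := leq_trans (leq_bigmax_cond _ anti) w; rewrite card3.
Qed.

Lemma prime_coordinate_prime (B : fin_bichain) :
  prime_bichain B -> coordinate_prime (rank (le1 B)) (rank (le2 B)).
Proof.
move=> pr M M1 M2; apply: pr; split=> x y z xM zM.
  by rewrite -!(leq_rank _ _ (le1_linear B)); apply: M1.
by rewrite -!(leq_rank _ _ (le2_linear B)); apply: M2.
Qed.

Lemma linear_preim (V W : Type) (f : W -> V) (r : rel V) :
  injective f -> linear_order r -> linear_order (relpre f r).
Proof.
move=> finj [rr ra rt rtot]; split=> [x|x y /ra /finj //|y x z|x y] /=.
- exact: rr.
- exact: rt.
- exact: rtot.
Qed.

(** * Finite prefixes and ages *)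

Definition prefix (X : bichain nat) (n : nat) : fin_bichain :=
  @FinBichain 'I_n (Bichain
    (linear_preim (@ord_inj n) (le1_linear X))
    (linear_preim (@ord_inj n) (le2_linear X))).

Lemma linear_homo_mono (V : Type) (r : rel V) (s : rel nat) (n : nat) (f : 'I_n -> V) :
  linear_order r -> linear_order s ->
  (forall i j : 'I_n, ~~ s j i -> ~~ r (f j) (f i)) ->
  forall i j : 'I_n, r (f i) (f j) = s i j.
Proof.
move=> [rr _ _ rtot] [_ sa _ stot] homo i j; apply/idP/idP => [|sij].
  by apply: contraTT; exact: homo.
case sji : (s j i); last first.
  by have := homo _ _ (negbT sji); have := rtot (f i) (f j);
    case: (r (f i) (f j)); case: (r (f j) (f i)).
by have /ord_inj -> : i = j :> nat by apply: sa; rewrite sij.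
Qed.

Lemma contains_prefix_embeds (X : bichain nat) (n : nat) (B : fin_bichain) :
  contains_prefix X n (rank (le1 B)) (rank (le2 B)) -> embeds (prefix X n) B.
Proof.
case=> f fP; exists (fun i => f (val i)).
have m1 : forall i j : 'I_n, le1 B (f i) (f j) = le1 X i j.
  apply: linear_homo_mono; [exact: le1_linear|exact: le1_linear|move=> i j ji].
  rewrite -(leq_rank _ _ (le1_linear B)) -ltnNge.
  by have [h _] := fP i j (ltn_ord i) (ltn_ord j); exact: h.
have m2 : forall i j : 'I_n, le2 B (f i) (f j) = le2 X i j.
  apply: linear_homo_mono; [exact: le2_linear|exact: le2_linear|move=> i j ji].
  rewrite -(leq_rank _ _ (le2_linear B)) -ltnNge.
  by have [_ h] := fP i j (ltn_ord i) (ltn_ord j); exact: h.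
split=> // i j fij; have [r1 a1 _ _] := le1_linear X; have [r2 _ _ _] := le1_linear B.
by apply/ord_inj/a1; rewrite -!m1 fij r2.
Qed.

Lemma contains_prefix_transpose (X : bichain nat) (n : nat) (V : Type) (a b : V -> nat) :
  contains_prefix X n b a -> contains_prefix (transpose X) n a b.
Proof.
by case=> f fP; exists f => i j ni nj; have [? ?] := fP i j ni nj.
Qed.

Lemma large_prime_embeds_prefix (B : fin_bichain) (n : nat) :
  prime_bichain B -> width (o B) <= 2 -> (4 * n).+1 ^ n.+1 + 2 < #|B| ->
  [\/ embeds (prefix B1 n) B, embeds (prefix (transpose B1) n) B |
      embeds (prefix B2 n) B].
Proof.
move=> pr w big.
have [] := large_prime_contains_prefix (rank_inj (le1_linear B)) (rank_inj (le2_linear B))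
  (width2_avoids321 w) (prime_coordinate_prime pr) big => h.
- by constructor 1; apply: contains_prefix_embeds.
- by constructor 2; apply/contains_prefix_embeds/contains_prefix_transpose.
- by constructor 3; apply: contains_prefix_embeds.
Qed.

Lemma embeds_trans (U V W : Type) (A : bichain U) (B : bichain V) (D : bichain W) :
  embeds A B -> embeds B D -> embeds A D.
Proof.
move=> [f [fi f1 f2]] [g [gi g1 g2]]; exists (g \o f); split=> [|x y|x y] /=.
- exact: inj_comp.
- by rewrite g1 f1.
- by rewrite g2 f2.
Qed.

Lemma prefix_embeds (X : bichain nat) (n : nat) : embeds (prefix X n) X.
Proof. by exists val; split=> //; exact: ord_inj. Qed.

Lemma embeds_prefix (X : bichain nat) (A : fin_bichain) (n : nat) (f : A -> nat) :
  is_embedding A X f -> (forall x, f x < n) -> embeds A (prefix X n).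
Proof.
move=> [fi f1 f2] fn; exists (fun x => Ordinal (fn x)); split=> [x y []|x y|x y] /=.
- exact: fi.
- exact: f1.
- exact: f2.
Qed.

Lemma prefix_leq (X : bichain nat) (m n : nat) :
  m <= n -> embeds (prefix X m) (prefix X n).
Proof.
move=> mn; apply: (@embeds_prefix X (prefix X m) n val); first by split=> //; exact: ord_inj.
by move=> x; exact: leq_trans (ltn_ord x) mn.
Qed.

(** A finite set has bounded image in the integers, so an embedding into [X] lands in a prefix. *)
Lemma age_subclass (C : bichain_class) (X : bichain nat) :
  hereditary C -> (forall n, C (prefix X n)) -> subclass (age X) C.
Proof.
move=> her pre A [f fA]; apply: her (pre (\max_x f x).+1).
by apply: embeds_prefix fA _ => x; rewrite ltnS leq_bigmax.
Qed.

Lemma age_hereditary (V : Type) (X : bichain V) : hereditary (age X).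
Proof. by move=> A B; exact: embeds_trans. Qed.

Lemma isomorphic_card (A B : fin_bichain) : isomorphic A B -> #|A| = #|B|.
Proof. by case=> f /bij_eq_card. Qed.

(** A finite list of bichains has bounded sizes, and some prime prefix exceeds the bound. *)
Lemma age_infinitely_many_primes (X : bichain nat) :
  (forall N, exists2 n, N < n & prime_bichain (prefix X n)) ->
  ~ finitely_many_primes (age X).
Proof.
move=> big [n [F FP]]; have [m Nm pm] := big (\max_i #|F i|).
have [i /isomorphic_card] := FP _ (prefix_embeds X m) pm.
rewrite /= card_ord => E.
by have := leq_bigmax (F := fun i => #|F i|) i; rewrite /= -E leqNgt Nm.
Qed.

Lemma minimal_prime_age (C : bichain_class) (X : bichain nat) :
  minimal_prime C -> ~ finitely_many_primes (age X) ->
  (forall n, C (prefix X n)) -> same_class C (age X).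
Proof.
move=> [her _ min] inf pre; have sub := age_subclass her pre.
apply: NNPP => ne; apply/inf/min; first exact: age_hereditary.
by split=> // same; apply: ne => B; split=> /same.
Qed.

(** * Arbitrarily long prime prefixes *)

Lemma prime_prefix_transpose (X : bichain nat) (n : nat) :
  prime_bichain (prefix X n) -> prime_bichain (prefix (transpose X) n).
Proof. by move=> pr M [M1 M2]; apply: pr. Qed.

Lemma nontrivial_pair (n : nat) (M : {set 'I_n}) :
  ~ is_trivial M -> exists x y : 'I_n, [/\ x \in M, y \in M & x < y].
Proof.
move=> nt; have [M0|[x xM]] := set_0Vmem M; first by case: nt; constructor 1.
have [E|] := eqVneq M [set x]; first by case: nt; constructor 2; exists x.
rewrite eqEsubset sub1set xM andbT => /subsetPn [y yM]; rewrite inE => yx.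
case: (ltngtP x y) => xy; first by exists x, y.
  by exists y, x.
by move: yx; rewrite (ord_inj xy) eqxx.
Qed.

(** A module with two points contains consecutive integers, hence both parities. In the second order
    the last odd integer and [0] lie between them; as the length is even, these are the two ends of
    the natural order. *)
Lemma prime_prefix_B1 (k : nat) : prime_bichain (prefix B1 k.*2).
Proof.
move=> M [M1 M2]; apply: NNPP => nt; have [x [y [xM yM xy]]] := nontrivial_pair nt.
have s_ord : x.+1 < k.*2 by have := ltn_ord y; lia.
pose s := Ordinal s_ord.
have sM : s \in M by apply: (M1 x s y) => //=; lia.
have hz : 0 < k.*2 by lia.
have ht : k.*2.-1 < k.*2 by lia.
have [zM tM] : Ordinal hz \in M /\ Ordinal ht \in M.
  case ox : (odd x); split.
  - apply: (M2 x _ s) => //; rewrite /= /le_omega_omega /=; repeat case: ifP; lia.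
  - apply: (M2 x _ s) => //; rewrite /= /le_omega_omega /=; repeat case: ifP; lia.
  - apply: (M2 s _ x) => //; rewrite /= /le_omega_omega /=; repeat case: ifP; lia.
  - apply: (M2 s _ x) => //; rewrite /= /le_omega_omega /=; repeat case: ifP; lia.
case: nt; constructor 3; apply/setP => w; rewrite inE.
by apply: (M1 _ w _ zM tM) => //=; have := ltn_ord w; lia.
Qed.

(** A module with two points contains a consecutive pair, and such a pair spreads down to [0, 1] and
    then up to the last index. Going up from an odd [m] uses [m.+3], present because the last index
    is even; going up from [0] uses the index 4, whence [k.+2]. *)
Lemma prime_prefix_B2 (k : nat) : prime_bichain (prefix B2 k.+2.*2.+1).
Proof.
have sigmaE m : sigma m = if m == 0 then 1 else if odd m then m + 2 else m - 2.
  by case: m => [|[|m]].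
move=> M [M1 M2]; apply: NNPP => nt; have [x [y [xM yM xy]]] := nontrivial_pair nt.
pose inM m := exists2 i : 'I_(k.+2.*2.+1), i \in M & val i = m.
have ivl1 l m u : inM l -> inM u -> l <= m -> m <= u -> inM m.
  move=> [i iM <-] [j jM <-] im mj; have mk : m < k.+2.*2.+1 := leq_ltn_trans mj (ltn_ord j).
  by exists (Ordinal mk) => //; apply: (M1 i _ j).
have ivl2 l m u : inM l -> inM u -> sigma l <= sigma m -> sigma m <= sigma u ->
    m <= k.+2.*2 -> inM m.
  move=> [i iM <-] [j jM <-] im mj mk; exists (Ordinal (mk : m < k.+2.*2.+1)) => //.
  by apply: (M2 i _ j).
have down m : inM m.+1 -> inM m.+2 -> inM m /\ inM m.+1.
  move=> m1 m2; split=> //; have [i _ E] := m2; have mk : m.+2 <= k.+2.*2.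
    by rewrite -ltnS -E; exact: ltn_ord.
  case om : (odd m).
    have [|m0] := posnP m; first by move=> m0; rewrite m0 in om.
    by apply: (ivl2 m.+1 m m.+2) => //; rewrite ?sigmaE; repeat case: ifP; lia.
  have [m0|m0] := posnP m.
    by apply: (ivl2 m.+2 m m.+1) => //; rewrite ?sigmaE; repeat case: ifP; lia.
  apply: (ivl1 m.-1 m m.+1) => //; try lia.
  apply: (ivl2 m.+2 m.-1 m.+1) => //; rewrite ?sigmaE; repeat case: ifP; lia.
have up m : inM m -> inM m.+1 -> m.+2 <= k.+2.*2 -> inM m.+1 /\ inM m.+2.
  move=> m0 m1 mk; split=> //; case om : (odd m).
    have [?|?] := leqP m.+3 k.+2.*2; last lia.
    apply: (ivl1 m m.+2 m.+3) => //; try lia.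
    by apply: (ivl2 m.+1 m.+3 m) => //; rewrite ?sigmaE; repeat case: ifP; lia.
  have [E|mpos] := posnP m.
    by subst m; apply: (ivl1 1 2 4) => //; apply: (ivl2 0 4 1).
  by apply: (ivl2 m m.+2 m.+1) => //; rewrite ?sigmaE; repeat case: ifP; lia.
have start m : inM m -> inM m.+1 -> inM 0 /\ inM 1.
  by elim: m => // m IH m1 m2; have [] := down m m1 m2; exact: IH.
have all m : m.+1 <= k.+2.*2 -> inM m /\ inM m.+1.
  elim: m => [_|m IH mk]; last by have [] := IH (ltnW mk); move=> ? ?; apply: up.
  apply: (start x); first by exists x.
  by apply: (ivl1 x _ y) => //; [exists x|exists y].
case: nt; constructor 3; apply/setP => w; rewrite inE.
have [i iM /ord_inj <- //] : inM w.
have := ltn_ord w; rewrite ltnS leq_eqVlt => /orP [/eqP ->|/all [] //].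
by have [] := all k.+2.*2.-1 (leqnn _).
Qed.

(** * Finitely many isomorphism types of bounded size *)

(** The order transported to indices by [enum_rank], as an element of a finite type independent of
    [B]; entries beyond the size of [B] are false. *)
Definition order_table (N : nat) (B : fin_bichain) (r : rel B) : {ffun 'I_N * 'I_N -> bool} :=
  [ffun ij : 'I_N * 'I_N => [exists x, exists y,
     [&& enum_rank x == ij.1 :> nat, enum_rank y == ij.2 :> nat & r x y]]].

Lemma order_tableE (N : nat) (B : fin_bichain) (r : rel B) (i j : 'I_N) (x y : B) :
  enum_rank x = i :> nat -> enum_rank y = j :> nat -> order_table N r (i, j) = r x y.
Proof.
move=> xi yj; rewrite ffunE /=; apply/existsP/idP => [[x' /existsP [y']]|rxy].
  rewrite -xi -yj => /and3P [/eqP /ord_inj /enum_rank_inj ->].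
  by move=> /eqP /ord_inj /enum_rank_inj ->.
by exists x; apply/existsP; exists y; rewrite xi yj !eqxx.
Qed.

Definition order_tables (N : nat) (B : fin_bichain) :=
  (inord #|B| : 'I_N.+1, order_table N (le1 B), order_table N (le2 B)).

Lemma order_tables_isomorphic (N : nat) (A B : fin_bichain) :
  #|A| <= N -> #|B| <= N -> order_tables N A = order_tables N B -> isomorphic A B.
Proof.
move=> AN BN [/(congr1 val) /=]; rewrite !inordK // => cardE t1 t2.
pose f (x : A) : B := enum_val (cast_ord cardE (enum_rank x)).
have rank_lt (x : A) : enum_rank x < N by apply: leq_trans (ltn_ord _) AN.
have rank_f (x : A) : enum_rank (f x) = enum_rank x :> nat by rewrite /f enum_valK.
exists f.
  exists (fun y : B => enum_val (cast_ord (esym cardE) (enum_rank y))) => x.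
    by rewrite /f enum_valK cast_ordK enum_rankK.
  by rewrite /f enum_valK cast_ordKV enum_rankK.
split=> [x y fxy|x y|x y].
- by apply/enum_rank_inj/ord_inj; rewrite -!rank_f fxy.
- rewrite -(@order_tableE N A _ (Ordinal (rank_lt x)) (Ordinal (rank_lt y))) // t1.
  by apply/esym/order_tableE; rewrite rank_f.
- rewrite -(@order_tableE N A _ (Ordinal (rank_lt x)) (Ordinal (rank_lt y))) // t2.
  by apply/esym/order_tableE; rewrite rank_f.
Qed.

Lemma large_primes (C : bichain_class) (N : nat) :
  ~ finitely_many_primes C -> exists B, [/\ C B, prime_bichain B & N < #|B|].
Proof.
move=> inf; apply: NNPP => no; apply: inf.
pose T : finType := ('I_N.+1 * {ffun 'I_N * 'I_N -> bool} * {ffun 'I_N * 'I_N -> bool})%type.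
(* One representative is chosen for each code; the default [prefix B1 0] only serves codes that no
   bichain of size at most [N] realises. *)
pose F (i : 'I_#|T|) := epsilon (inhabits (prefix B1 0))
  (fun G : fin_bichain => #|G| <= N /\ order_tables N G = enum_val i).
exists #|T|, F => B CB pB.
have BN : #|B| <= N by rewrite leqNgt; apply/negP => NB; apply: no; exists B.
exists (enum_rank (order_tables N B : T)).
have [FN FE] := epsilon_spec (inhabits (prefix B1 0))
  (fun G : fin_bichain => #|G| <= N /\
     order_tables N G = enum_val (enum_rank (order_tables N B : T)))
  (ex_intro _ B (conj BN (esym (enum_rankK _)))).
by apply: order_tables_isomorphic BN FN _; rewrite FE enum_rankK.
Qed.

(** * Choice of the bichain and use of minimality *)

Theorem mainTheorem8 (C : bichain_class)
  (C_minimal_prime : minimal_prime C)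
  (C_width : forall B : fin_bichain, C B -> width (o B) <= 2) :
  [\/ same_class C (age B1), same_class C (age (transpose B1)) |
      same_class C (age B2)].
Proof.
have [her inf _] := C_minimal_prime.
have some n : [\/ C (prefix B1 n), C (prefix (transpose B1) n) | C (prefix B2 n)].
  have [B [CB pB big]] := large_primes ((4 * n).+1 ^ n.+1 + 2) inf.
  have [e|e|e] := large_prime_embeds_prefix pB (C_width B CB) big.
  - by constructor 1; apply: her e CB.
  - by constructor 2; apply: her e CB.
  - by constructor 3; apply: her e CB.
have mono X m n : m <= n -> C (prefix X n) -> C (prefix X m).
  by move=> mn; apply: her; exact: prefix_leq.
have inf1 : ~ finitely_many_primes (age B1).
  apply: age_infinitely_many_primes => N; exists N.+1.*2; first lia.
  exact: prime_prefix_B1.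
have inf1t : ~ finitely_many_primes (age (transpose B1)).
  apply: age_infinitely_many_primes => N; exists N.+1.*2; first lia.
  exact/prime_prefix_transpose/prime_prefix_B1.
have inf2 : ~ finitely_many_primes (age B2).
  apply: age_infinitely_many_primes => N; exists N.+2.*2.+1; first lia.
  exact: prime_prefix_B2.
apply: NNPP => none.
have fail X : ~ same_class C (age X) -> ~ finitely_many_primes (age X) ->
    exists n, ~ C (prefix X n).
  move=> ne infX; apply: not_all_ex_not => pre.
  by apply: ne; apply: minimal_prime_age.
have [|n1 f1] := fail B1 _ inf1; first by move=> e; apply: none; constructor 1.
have [|n2 f2] := fail (transpose B1) _ inf1t; first by move=> e; apply: none; constructor 2.
have [|n3 f3] := fail B2 _ inf2; first by move=> e; apply: none; constructor 3.
(* If each bichain had a prefix outside [C], then at the largest of the three lengths none of the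
   alternatives could hold, since [C] is closed under shortening prefixes. *)
have [c|c|c] := some (maxn n1 (maxn n2 n3)).
- by apply/f1/(mono _ _ _ _ c); rewrite leq_maxl.
- by apply/f2/(mono _ _ _ _ c); rewrite !leq_max leqnn orbT.
- by apply/f3/(mono _ _ _ _ c); rewrite !leq_max leqnn !orbT.
Qed.
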